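(* Let $\langle\mathfrak K^{\heartsuit},\mathfrak K\rangle$ be a directed normed category with the almost amalgamation property. The following conditions are equivalent: (a) $\langle\mathfrak K^{\heartsuit},\mathfrak K\rangle$ is separable. (b) $\langle\mathfrak K^{\heartsuit},\mathfrak K\rangle$ has a Fraïssé sequence. Furthermore, if $\mathcal F$ is a countable directed dominating subcategory of $\langle\mathfrak K^{\heartsuit},\mathfrak K\rangle$ with the almost amalgamation property, then there exists a sequence in $\mathcal F$ that is Fraïssé in $\langle\mathfrak K^{\heartsuit},\mathfrak K\rangle$.
   Context: A category $\mathfrak K$ is metric-enriched if each hom-set $\mathfrak K(a,b)$ carries a metric $\rho$ (the value $+\infty$ is allowed) such that $\rho(f_0\circ g,f_1\circ g)\leqslant\rho(f_0,f_1)$ and $\rho(h\circ f_0,h\circ f_1)\leqslant\rho(f_0,f_1)$ whenever the compositions make sense. A normed category is a pair $\langle\mathfrak K^{\heartsuit},\mathfrak K\rangle$ where $\mathfrak K$ is a metric-enriched category and $\mathfrak K^{\heartsuit}$ is a subcategory of $\mathfrak K$ with the same objects. For $f\in\mathfrak K$ put $\mu(f)=\inf\{\rho(j\circ f,i)\colon i,j\in\mathfrak K^{\heartsuit},\ \operatorname{dom}(j)=\operatorname{cod}(f),\ \operatorname{dom}(i)=\operatorname{dom}(f),\ \operatorname{cod}(i)=\operatorname{cod}(j)\}$, with $\inf\emptyset=+\infty$. A category $\mathfrak C$ is directed if for all objects $a,b$ there is an object $c$ with $\mathfrak C(a,c)$ and $\mathfrak C(b,c)$ nonempty. A metric-enriched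 category $\mathfrak C$ has the almost amalgamation property if for all arrows $f\colon c\to a$, $g\colon c\to b$ of $\mathfrak C$ and every $\varepsilon>0$ there are arrows $f'\colon a\to w$, $g'\colon b\to w$ of $\mathfrak C$ with $\rho(f'\circ f,g'\circ g)<\varepsilon$. The normed category $\langle\mathfrak K^{\heartsuit},\mathfrak K\rangle$ is said to be directed, respectively to have the almost amalgamation property, if $\mathfrak K^{\heartsuit}$ does. A subcategory $\mathcal F$ of $\mathfrak K^{\heartsuit}$ is dominating in $\langle\mathfrak K^{\heartsuit},\mathfrak K\rangle$ if: ($D_1$) for every object $x$ of $\mathfrak K^{\heartsuit}$ and every $\varepsilon>0$ there is a $\mathfrak K$-arrow $f\colon x\to y$ with $y$ an object of $\mathcal F$ and $\mu(f)<\varepsilon$; ($D_2$) given $\varepsilon>0$ and a $\mathfrak K^{\heartsuit}$-arrow $f\colon a\to y$ with $a$ an object of $\mathcal F$, there exist a $\mathfrak K$-arrow $g\colon y\to b$ and an $\mathcal F$-arrow $u\colon a\to b$ with $\mu(g)<\varepsilon$ and $\rho(g\circ f,u)<\varepsilon$. The normed category is separable if there is a countable $\mathcal F\subseteq\mathfrak K^{\heartsuit}$ dominating in it. A sequence in a category is a covariant functor from the set of natural numbers $\omega$, with objects $u_n$ and arrows $u_n^m\colon u_n\to u_m$ for $n\leqslant m$. A sequence $\vec u$ in $\mathfrak K^{\heartsuit}$ is Fraïssé in $\langle\mathfrak K^{\heartsuit},\mathfrak K\rangle$ if: (U) for every object $x$ of $\mathfrak K^{\heartsuit}$ and every $\varepsilon>0$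 there are $n\in\omega$ and a $\mathfrak K$-arrow $f\colon x\to u_n$ with $\mu(f)<\varepsilon$; (A) given $\varepsilon>0$ and a $\mathfrak K^{\heartsuit}$-arrow $f\colon u_n\to y$, there are $m>n$ and a $\mathfrak K$-arrow $g\colon y\to u_m$ with $\mu(g)<\varepsilon$ and $\rho(u_n^m,g\circ f)<\varepsilon$. *)

(* Defs.v *)
From mathcomp Require Import all_boot all_order all_algebra.
From mathcomp Require Import boolp classical_sets cardinality reals ereal.

Set Implicit Arguments.
Unset Strict Implicit.
Unset Printing Implicit Defensive.

Local Open Scope classical_set_scope.
Local Open Scope ring_scope.
Local Open Scope ereal_scope.

Record category := Category {
  ob :> Type;
  hom : ob -> ob -> Type;
  idn : forall a, hom a a;
  comp : forall a b c, hom b c -> hom a b -> hom a c;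
  comp_idl : forall a b (f : hom a b), comp (idn b) f = f;
  comp_idr : forall a b (f : hom a b), comp f (idn a) = f;
  compA : forall a b c d (h : hom c d) (g : hom b c) (f : hom a b),
    comp h (comp g f) = comp (comp h g) f }.

Arguments hom {_} a b.
Arguments idn {_} a.
Arguments comp {_ a b c} g f.

Declare Scope arrow_scope.
Delimit Scope arrow_scope with arrow.
Notation "g ∘ f" := (comp g f) (at level 40, left associativity) : arrow_scope.
Local Open Scope arrow_scope.

Record metric_category (R : realType) := MetricCategory {
  mc_cat :> category;
  rho : forall a b : mc_cat, hom a b -> hom a b -> \bar R;
  rho_ge0 : forall (a b : mc_cat) (f g : hom a b), 0 <= rho f g;
  rho_eq0 : forall (a b : mc_cat) (f g : hom a b), rho f g = 0 <-> f = g;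
  rhoC : forall (a b : mc_cat) (f g : hom a b), rho f g = rho g f;
  rho_triangle : forall (a b : mc_cat) (f g h : hom a b),
    rho f h <= rho f g + rho g h;
  rho_compr : forall (a b c : mc_cat) (f0 f1 : hom b c) (g : hom a b),
    rho (f0 ∘ g) (f1 ∘ g) <= rho f0 f1;
  rho_compl : forall (a b c : mc_cat) (h : hom b c) (f0 f1 : hom a b),
    rho (h ∘ f0) (h ∘ f1) <= rho f0 f1 }.

Arguments rho {R m a b} f g.

Record subcategory (C : category) := Subcategory {
  sub_ob : set C;
  sub_hom : forall a b : C, set (hom a b);
  sub_dom : forall (a b : C) (f : hom a b), sub_hom f -> sub_ob a;
  sub_cod : forall (a b : C) (f : hom a b), sub_hom f -> sub_ob b;
  sub_idn : forall a : C, sub_ob a -> sub_hom (idn a);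
  sub_comp : forall (a b c : C) (g : hom b c) (f : hom a b),
    sub_hom g -> sub_hom f -> sub_hom (g ∘ f) }.

Arguments sub_ob {C} s.
Arguments sub_hom {C} s {a b}.

Definition is_subcategory_of (C : category) (S T : subcategory C) : Prop :=
  sub_ob S `<=` sub_ob T /\
  forall a b : C, @sub_hom C S a b `<=` @sub_hom C T a b.

(* Only arrows are counted: the objects embed into them via identities. *)
Definition countable_subcategory (C : category) (S : subcategory C) : Prop :=
  countable [set f : {a : C & {b : C & hom a b}} |
             sub_hom S (projT2 (projT2 f))].

Definition directed (C : category) (S : subcategory C) : Prop :=
  forall a b : C, sub_ob S a -> sub_ob S b ->
  exists (c : C) (f : hom a c) (g : hom b c), sub_hom S f /\ sub_hom S g.

Definition almost_amalgamation (R : realType) (K : metric_category R)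
    (S : subcategory K) : Prop :=
  forall (c a b : K) (f : hom c a) (g : hom c b) (eps : R),
  sub_hom S f -> sub_hom S g -> (0 < eps)%R ->
  exists (w : K) (f' : hom a w) (g' : hom b w),
    [/\ sub_hom S f', sub_hom S g' & rho (f' ∘ f) (g' ∘ g) < eps%:E].

Record normed_category (R : realType) := NormedCategory {
  nc_cat :> metric_category R;
  heart : subcategory nc_cat;
  heart_ob : forall a : nc_cat, sub_ob heart a }.

Arguments heart {R} n.

Definition mu (R : realType) (K : normed_category R) (a b : K) (f : hom a b)
    : \bar R :=
  ereal_inf [set r | exists (c : K) (j : hom b c) (i : hom a c),
    [/\ sub_hom (heart K) j, sub_hom (heart K) i & r = rho (j ∘ f) i]].

Definition dominating (R : realType) (K : normed_category R)
    (F : subcategory K) : Prop :=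
  [/\ is_subcategory_of F (heart K),
      forall (x : K) (eps : R), (0 < eps)%R ->
        exists (y : K) (f : hom x y), sub_ob F y /\ mu f < eps%:E
    & forall (eps : R) (a y : K) (f : hom a y), (0 < eps)%R ->
        sub_ob F a -> sub_hom (heart K) f ->
        exists (b : K) (g : hom y b) (u : hom a b),
          [/\ sub_hom F u, mu g < eps%:E & rho (g ∘ f) u < eps%:E]].

Definition separable (R : realType) (K : normed_category R) : Prop :=
  exists F : subcategory K, countable_subcategory F /\ dominating F.

Record omega_sequence (C : category) := OmegaSequence {
  sq_ob :> nat -> C;
  sq_hom : forall n m : nat, (n <= m)%N -> hom (sq_ob n) (sq_ob m);
  sq_idn : forall (n : nat) (nn : (n <= n)%N), sq_hom nn = idn (sq_ob n);
  sq_comp : forall (n m k : nat) (nm : (n <= m)%N) (mk : (m <= k)%N)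
    (nk : (n <= k)%N), sq_hom nk = sq_hom mk ∘ sq_hom nm }.

Arguments sq_hom {C} o {n m} _.

Definition sequence_in (C : category) (S : subcategory C)
    (u : omega_sequence C) : Prop :=
  (forall n, sub_ob S (u n)) /\
  (forall (n m : nat) (nm : (n <= m)%N), sub_hom S (sq_hom u nm)).

Definition fraisse (R : realType) (K : normed_category R)
    (u : omega_sequence K) : Prop :=
  [/\ sequence_in (heart K) u,
      forall (x : K) (eps : R), (0 < eps)%R ->
        exists (n : nat) (f : hom x (u n)), mu f < eps%:E
    & forall (eps : R) (n : nat) (y : K) (f : hom (u n) y), (0 < eps)%R ->
        sub_hom (heart K) f ->
        exists (m : nat) (nm : (n < m)%N) (g : hom y (u m)),
          mu g < eps%:E /\ rho (sq_hom u (ltnW nm)) (g ∘ f) < eps%:E].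

(* Main.v *)
Require Import Defs.
From mathcomp Require Import all_boot all_order all_algebra.
From mathcomp Require Import boolp classical_sets cardinality reals ereal.
From mathcomp Require Import lra.
(* [hom] and [comp] denote arrows and composition of a category again. *)
Import Defs.

Set Implicit Arguments.
Unset Strict Implicit.
Unset Printing Implicit Defensive.

Import Order.TTheory GRing.Theory Num.Theory.

Local Open Scope classical_set_scope.
Local Open Scope arrow_scope.

(** A Fraïssé sequence is a generic sequence: it is obtained by meeting
countably many requirements, each of which can be met at any finite stage of
the construction, with a bookkeeping that imposes every requirement on every
object of the sequence at some later stage ([generic_sequence]).

Let F be countable and dominating. The difficulty is that condition (A) speaks
about all arrows f : u_n -> y of the heart, of which there may be too many,
and that u_n may fail to be an object of F. So for every object a and every
tolerance d one fixes an arrow h : a -> x of small mu into an object of F,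
together with arrows i, j witnessing that mu is small ([anchor]). The
requirements on the sequence are then, for all n and d and each of the
countably many F-arrows r : x -> b out of the anchor x of u_n, that some later
u_m receives an arrow v : b -> u_m with v r h close to the bonding arrow
u_n -> u_m; moreover every object of F has to be sent to some u_m. A single
extension meets such a requirement, by two amalgamations in the first case
([anchored_extension]) and by directedness in the second.

This suffices for (A): given f : u_n -> y, amalgamate f and i into
f' f ~ g' i, and apply domination to g' j : x -> w to get q g' j ~ r with r in
F. If v is the arrow provided for r, then
  v q f' f ~ v q g' i ~ v q g' j h ~ v r h ~ (u_n -> u_m),
so v q f' is the required arrow; its mu is small because mu (q) is, and
because composing with heart arrows hardly increases mu
([mu_comp_heartr], [mu_comp_heartl]).

The construction takes place in any directed subcategory S with the almost
amalgamation property that lies between F and the heart and contains the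
arrows i, j of the anchors ([fraisse_sequence_in]). For S the heart, the
anchors are given by domination, and separability yields a Fraïssé sequence
in the heart. For S = F the anchors are identities, and the sequence lies
in F.

Conversely, the bonding arrows of a Fraïssé sequence generate a countable
subcategory, and (U) and (A) say that it is dominating. *)

(** * Estimates for the metric and for mu *)

Lemma rho_lt_trans (R : realType) (K : metric_category R) (a b : K)
    (g f h : hom a b) (d d' : R) :
  (rho f g < d%:E)%E -> (rho g h < d'%:E)%E -> (rho f h < (d + d')%:E)%E.
Proof.
by move=> fg gh; rewrite EFinD (le_lt_trans (rho_triangle f g h))// lteD.
Qed.

Lemma rho_lt_compl (R : realType) (K : metric_category R) (a b c : K)
    (h : hom b c) (f g : hom a b) (d : R) :
  (rho f g < d%:E)%E -> (rho (h ∘ f) (h ∘ g) < d%:E)%E.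
Proof. exact/le_lt_trans/rho_compl. Qed.

Lemma rho_lt_compr (R : realType) (K : metric_category R) (a b c : K)
    (h : hom a b) (f g : hom b c) (d : R) :
  (rho f g < d%:E)%E -> (rho (f ∘ h) (g ∘ h) < d%:E)%E.
Proof. exact/le_lt_trans/rho_compr. Qed.

Lemma mu_ltP (R : realType) (K : normed_category R) (a b : K) (f : hom a b)
    (d : R) :
  (mu f < d%:E)%E <-> exists (c : K) (j : hom b c) (i : hom a c),
    [/\ sub_hom (heart K) j, sub_hom (heart K) i & (rho (j ∘ f) i < d%:E)%E].
Proof.
split=> [/ereal_inf_lt[_ [c [j [i [Hj Hi ->]]]] lt_d]|[c [j [i [Hj Hi lt_d]]]]].
  by exists c, j, i.
by apply: le_lt_trans lt_d; apply: ereal_inf_lbound; exists c, j, i.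
Qed.

(** Precomposing a witness j g ~ i of small mu with the heart arrow f gives the
witness j (g f) ~ i f. *)
Lemma mu_comp_heartr (R : realType) (K : normed_category R) (a b c : K)
    (g : hom b c) (f : hom a b) (d : R) :
  sub_hom (heart K) f -> (mu g < d%:E)%E -> (mu (g ∘ f) < d%:E)%E.
Proof.
move=> Hf /mu_ltP[w [j [i [Hj Hi ji]]]]; apply/mu_ltP.
exists w, j, (i ∘ f); split=> //; first exact: sub_comp.
by rewrite compA; apply: rho_lt_compr.
Qed.

(** A witness j f ~ i says nothing about g f, for j and g both start at b; their
amalgamation, at an arbitrarily small cost e, replaces j by an arrow that
factors through g. *)
Lemma mu_comp_heartl (R : realType) (K : normed_category R) (a b c : K)
    (g : hom b c) (f : hom a b) (d e : R) :
  almost_amalgamation (heart K) ->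
  sub_hom (heart K) g -> (0 < e)%R -> (mu f < d%:E)%E ->
  (mu (g ∘ f) < (e + d)%:E)%E.
Proof.
move=> amalg Hg e0 /mu_ltP[w [j [i [Hj Hi ji]]]]; apply/mu_ltP.
have [z [g' [j' [Hg' Hj' gj]]]] := amalg _ _ _ _ _ _ Hg Hj e0.
exists z, g', (j' ∘ i); split=> //; first exact: sub_comp.
rewrite compA; apply: (@rho_lt_trans _ _ _ _ ((j' ∘ j) ∘ f)).
  exact: rho_lt_compr.
by rewrite -compA; apply: rho_lt_compl.
Qed.

(** * Sequences from consecutive arrows *)

(** Indexing by the number d of steps makes the target [u (d + n)] compute along
the recursion, so that no transport occurs here. *)
Fixpoint climb (C : category) (u : nat -> C)
    (s : forall n, hom (u n) (u n.+1)) (n d : nat) : hom (u n) (u (d + n)) :=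
  if d is d'.+1 then s (d' + n) ∘ climb s n d' else idn (u n).

Definition bonding (C : category) (u : nat -> C)
    (s : forall n, hom (u n) (u n.+1)) (n m : nat)
    (nm : (n <= m)%N) : hom (u n) (u m) :=
  ecast k (hom (u n) (u k)) (subnK nm) (climb s n (m - n)).

Lemma bonding_climb (C : category) (u : nat -> C)
    (s : forall n, hom (u n) (u n.+1)) (n d : nat)
    (nm : (n <= d + n)%N) :
  bonding s nm = climb s n d.
Proof.
by rewrite /bonding; move: (subnK nm); rewrite addnK => e; rewrite eq_axiomK.
Qed.

Lemma bonding_id (C : category) (u : nat -> C)
    (s : forall n, hom (u n) (u n.+1)) (n : nat)
    (nn : (n <= n)%N) :
  bonding s nn = idn (u n).
Proof. exact: (bonding_climb s (d := 0)). Qed.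

Lemma bondingS (C : category) (u : nat -> C)
    (s : forall n, hom (u n) (u n.+1)) (n m : nat)
    (nm : (n <= m)%N) (nm1 : (n <= m.+1)%N) :
  bonding s nm1 = s m ∘ bonding s nm.
Proof.
have [d m_def] : exists d, m = (d + n)%N by exists (m - n)%N; rewrite subnK.
subst m; rewrite bonding_climb.
exact: (bonding_climb s (d := d.+1)).
Qed.

Lemma bonding_comp (C : category) (u : nat -> C)
    (s : forall n, hom (u n) (u n.+1)) (n m k : nat)
    (nm : (n <= m)%N) (mk : (m <= k)%N) (nk : (n <= k)%N) :
  bonding s nk = bonding s mk ∘ bonding s nm.
Proof.
have [d k_def] : exists d, k = (d + m)%N by exists (k - m)%N; rewrite subnK.
subst k; rewrite (bonding_climb s mk); elim: d mk nk => [|d IHd] mk nk /=.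
  by rewrite comp_idl; congr (bonding s _); apply: bool_irrelevance.
by rewrite -compA -(IHd (leq_addl d m) (leq_trans nm (leq_addl d m))) -bondingS.
Qed.

Definition bonding_sequence (C : category) (u : nat -> C)
    (s : forall n, hom (u n) (u n.+1)) : omega_sequence C :=
  OmegaSequence (bonding_id s) (bonding_comp s).

(** * Dovetailed construction of a sequence *)

(** At stage m of the construction a requirement t is imposed on the bonding
arrow out of the n-th object, where the pair (t, n) is decoded from m. The
code of a list of numbers exceeds its members, so the stage that encodes
(t, n) comes after the n-th object has been built; this is why lists of
numbers are decoded instead of pickled pairs. *)
Definition schedule (T : countType) (m : nat) : option T * nat :=
  match CodeSeq.decode m with
  | [:: i; n] => (unpickle i, n)
  | _ => (None, 0)
  end.

Lemma scheduleP (T : countType) (t : T) (n : nat) :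
  exists2 m, (n <= m)%N & schedule T m = (Some t, n).
Proof.
exists (CodeSeq.code [:: pickle t; n]); last first.
  by rewrite /schedule CodeSeq.codeK pickleK.
by have /and3P[_ /ltnW] := CodeSeq.ltn_code [:: pickle t; n].
Qed.

(** If every requirement t on arrows can be met by extending the target of the
arrow inside S, then dovetailing meets each of them at each object. Conditions
(U) and (A) are both obtained from requirements of this kind. *)
Lemma generic_sequence (C : category) (S : subcategory C) (T : countType)
    (P : T -> forall a w : C, hom a w -> Prop) (a0 : C) :
  sub_ob S a0 ->
  (forall t a w (e : hom a w), sub_hom S e ->
     exists (w' : C) (q : hom w w'), sub_hom S q /\ P t a w' (q ∘ e)) ->
  exists u : omega_sequence C, sequence_in S u /\
    forall t n, exists (m : nat) (nm : (n < m)%N),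
      P t (u n) (u m) (sq_hom u (ltnW nm)).
Proof.
move=> Sa0 dense.
pose into w := {a : C & hom a w}.
pose push w w' (q : hom w w') (p : into w) : into w' :=
  existT _ (projT1 p) (q ∘ projT2 p).
have ext (t : option T) w (p : into w) : {q : {w' : C & hom w w'} |
    sub_hom S (projT2 p) -> sub_hom S (projT2 q) /\
      if t is Some t' then P t' _ _ (projT2 q ∘ projT2 p) else True}.
  apply: cid; case: t => [t|]; last first.
    exists (existT _ w (idn w)) => Sp; split=> //=.
    exact/sub_idn/(sub_cod Sp).
  have [Sp|nSp] := pselect (sub_hom S (projT2 p)).
    have [w' [q qP]] := dense t _ _ _ Sp.
    by exists (existT _ w' q) => _; exact: qP.
  by exists (existT _ w (idn w)).
pose state := {w : C & nat -> into w}.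
pose self w : into w := existT (fun a => hom a w) w (idn w).
pose bond m (x : state) : {w' : C & hom (projT1 x) w'} :=
  sval (ext (schedule T m).1 _ (projT2 x (schedule T m).2)).
have bondP m (x : state) : (forall n, sub_hom S (projT2 (projT2 x n))) ->
    sub_hom S (projT2 (bond m x)) /\
    if (schedule T m).1 is Some t then
      P t _ _ (projT2 (bond m x) ∘ projT2 (projT2 x (schedule T m).2))
    else True.
  by move=> Sx; exact: svalP (ext _ _ _) (Sx _).
clearbody bond.
(* The state at stage m consists of the object u_m and of the history of arrows
   u_n -> u_m for n <= m, padded with identities. *)
pose next m (x : state) : state := existT _ (projT1 (bond m x)) (fun n =>
  if (n <= m)%N then push _ _ (projT2 (bond m x)) (projT2 x n) else self _).
pose st m := iteri m next (existT _ a0 (fun=> self a0)).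
pose u m := projT1 (st m).
pose s m : hom (u m) (u m.+1) := projT2 (bond m (st m)).
have Sst m : forall n, sub_hom S (projT2 (projT2 (st m) n)).
  elim: m => [|m IHm] n; first exact: sub_idn.
  have [Ss _] := bondP m _ IHm.
  rewrite /=; case: ifP => _ /=; first exact: sub_comp.
  exact/sub_idn/(sub_cod Ss).
have Ss m : sub_hom S (s m) by have [] := bondP m _ (Sst m).
have Su m : sub_ob S (u m) by exact: sub_dom (Ss m).
have hist m n (nm : (n <= m)%N) :
    projT2 (st m) n = existT _ (u n) (bonding s nm).
  elim: m nm => [|m IHm] nm.
    by case: n nm => // nm; rewrite bonding_id.
  rewrite /=; case: ifPn => [nm'|].
    by rewrite (IHm nm') /push /= (bondingS s nm').
  rewrite -ltnNge => mn; have n_def : n = m.+1 by apply/eqP; rewrite eqn_leq nm.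
  by subst n; rewrite bonding_id.
exists (bonding_sequence s); split.
  by split=> // n m nm; have := Sst m n; rewrite (hist m n nm).
move=> t n; have [m nm m_def] := scheduleP t n.
exists m.+1, nm; rewrite /= (bondingS s nm).
by have [_] := bondP m _ (Sst m); rewrite m_def /= (hist m n nm).
Qed.

(** * Enumerations of a countable subcategory *)

Lemma countable_enumeration (T : Type) (A : set T) (x0 : T) :
  A x0 -> countable A ->
  exists g : nat -> T, (forall n, A (g n)) /\ forall x, A x -> exists n, g n = x.
Proof.
move=> Ax0 /countable_injP[f f_inj].
have enum n : exists x, A x /\ forall y, A y -> f y = n -> x = y.
  have [[x Ax fx]|none] := pselect (exists2 x, A x & f x = n).
    exists x; split=> // y Ay fy; apply: f_inj; rewrite ?inE//.
    by rewrite fx fy.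
  by exists x0; split=> // y Ay fy; case: none; exists y.
have [g gP] := choice enum.
exists g; split=> [n|x Ax]; first by have [] := gP n.
by exists (f x); have [_] := gP (f x); exact.
Qed.

Lemma enumerate_objects (C : category) (F : subcategory C) (y0 : C) :
  countable_subcategory F -> sub_ob F y0 ->
  exists g : nat -> C, (forall n, sub_ob F (g n)) /\
    forall y, sub_ob F y -> exists n, g n = y.
Proof.
move=> countF Fy0; apply: (countable_enumeration Fy0).
have [f f_inj] := countable_injP _ countF.
pose one y : {a : C & {b : C & hom a b}} :=
  existT _ y (existT (fun b => hom y b) y (idn y)).
apply/countable_injP; exists (f \o one) => y z; rewrite !inE => Fy Fz /= fyz.
suff yz : one y = one z by exact: existT_inj1 yz.
by apply: f_inj => //; rewrite inE; exact: sub_idn.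
Qed.

Lemma enumerate_arrows_from (C : category) (F : subcategory C) (x : C) :
  countable_subcategory F -> sub_ob F x ->
  exists g : nat -> {b : C & hom x b}, (forall n, sub_hom F (projT2 (g n))) /\
    forall b (u : hom x b), sub_hom F u -> exists n, g n = existT _ b u.
Proof.
move=> countF Fx.
have [f f_inj] := countable_injP _ countF.
have [|g [Fg g_onto]] := @countable_enumeration {b : C & hom x b}
  [set z | sub_hom F (projT2 z)] (existT (fun b => hom x b) x (idn x))
  (sub_idn Fx).
  apply/countable_injP; exists (fun z => f (existT _ x z)) => y z.
  rewrite !inE => Fy Fz fyz.
  apply: (@existT_inj2 {classic C} (fun a : C => {b : C & hom a b}) x).
  by apply: f_inj; rewrite ?inE.
by exists g; split=> // b u Fu; exact: g_onto.
Qed.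

(** * The Fraïssé sequence *)

(** An approximate factorization of the S-arrow [anchor_in] out of a through an
object of F: it lets the countably many F-arrows out of that object control
all heart arrows out of a. The arrow [anchor_hom] is only near the heart: the
last field bounds its mu when S lies in the heart. *)
Record anchor (R : realType) (K : metric_category R) (F S : subcategory K)
    (a : K) (d : R) := Anchor {
  anchor_ob : K;
  anchor_hom : hom a anchor_ob;
  anchor_apex : K;
  anchor_out : hom anchor_ob anchor_apex;
  anchor_in : hom a anchor_apex;
  anchor_sub_ob : sub_ob F anchor_ob;
  anchor_sub_out : sub_hom S anchor_out;
  anchor_sub_in : sub_hom S anchor_in;
  anchor_lt : (rho (anchor_out ∘ anchor_hom) anchor_in < d%:E)%E }.

(** One amalgamation of u with the exit j of the anchor turns u h, which may lie
outside S, into an arrow close to an S-arrow out of a; that arrow can then be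
amalgamated with e. *)
Lemma anchored_extension (R : realType) (K : metric_category R)
    (F S : subcategory K) (a w : K) (d : R) (A : anchor F S a d)
    (e : hom a w) (b : K) (u : hom (anchor_ob A) b) :
  almost_amalgamation S -> (0 < d)%R -> sub_hom S e -> sub_hom S u ->
  exists (w' : K) (q : hom w w') (v : hom b w'),
    [/\ sub_hom S q, sub_hom S v &
        (rho (v ∘ (u ∘ anchor_hom A)) (q ∘ e) < (d + d + d)%:E)%E].
Proof.
case: A u => x h c j i /= Fx Sj Si ji u amalg d0 Se Su.
have [z [u' [j' [Su' Sj' uj]]]] := amalg _ _ _ _ _ _ Su Sj d0.
have [w' [p [q [Sp Sq pq]]]] := amalg _ _ _ _ _ _ (sub_comp Sj' Si) Se d0.
exists w', q, (p ∘ u'); split=> //; first exact: sub_comp.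
apply: rho_lt_trans pq; rewrite -compA; apply: rho_lt_compl.
apply: (@rho_lt_trans _ _ _ _ (j' ∘ j ∘ h)).
  by rewrite compA; apply: rho_lt_compr.
by rewrite -compA; apply: rho_lt_compl.
Qed.

(** F supplies the countably many requirements, S the amalgamations; the two
coincide when F itself has amalgamations, otherwise S is the heart. *)
Lemma fraisse_sequence_in (R : realType) (K : normed_category R)
    (F S : subcategory K) :
  inhabited K -> almost_amalgamation (heart K) ->
  countable_subcategory F -> dominating F ->
  is_subcategory_of F S -> is_subcategory_of S (heart K) ->
  directed S -> almost_amalgamation S ->
  (forall a (d : R), sub_ob S a -> (0 < d)%R -> inhabited (anchor F S a d)) ->
  exists u : omega_sequence K, sequence_in S u /\ fraisse u.
Proof.
move=> [x0] amalgK countF [_ D1 D2] [FSob FShom] [_ SK] dirS amalgS anchored.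
have [y0 [_ [Fy0 _]]] := D1 x0 1%R ltr01.
have [objs [Fobjs objs_onto]] := enumerate_objects countF Fy0.
pose tol k : R := (k.+1%:R^-1)%R.
have tol0 k : (0 < tol k)%R by rewrite invr_gt0 ltr0n.
have A a k (Sa : sub_ob S a) : anchor F S a (tol k).
  suff /cid[L _] : exists L : anchor F S a (tol k), True by [].
  by have [L] := anchored a _ Sa (tol0 k); exists L.
pose arr x (Fx : sub_ob F x) := sval (cid (enumerate_arrows_from countF Fx)).
have arrP x (Fx : sub_ob F x) : (forall n, sub_hom F (projT2 (arr x Fx n))) /\
    forall b (u : hom x b), sub_hom F u -> exists n, arr x Fx n = existT _ b u.
  exact: (svalP (cid (enumerate_arrows_from countF Fx))).
clearbody arr.
pose link a k Sa n := arr _ (anchor_sub_ob (A a k Sa)) n.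
pose req (t : nat + nat * nat) a w (e : hom a w) : Prop :=
  match t with
  | inl n => exists v : hom (objs n) w, sub_hom S v
  | inr (k, n) => forall Sa : sub_ob S a,
      exists2 v : hom (projT1 (link a k Sa n)) w, sub_hom S v &
        (rho (v ∘ (projT2 (link a k Sa n) ∘ anchor_hom (A a k Sa))) e
          < (tol k + tol k + tol k)%:E)%E
  end.
have [|t a w e Se|u [Su servedP]] := @generic_sequence K S _ req y0.
- exact: FSob.
- case: t => [n|[k n]].
    have [w' [v [q [Sv Sq]]]] := dirS _ _ (FSob _ (Fobjs n)) (sub_cod Se).
    by exists w', q; split=> //; exists v.
  have Sa := sub_dom Se.
  have [Flink _] := arrP _ (anchor_sub_ob (A a k Sa)).
  have [w' [q [v [Sq Sv vq]]]] :=
    anchored_extension amalgS (tol0 k) Se (FShom _ _ _ (Flink n)).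
  by exists w', q; split=> // Sa'; rewrite (Prop_irrelevance Sa' Sa); exists v.
exists u; split=> //; split.
- by case: Su => Sob Shom; split=> [n|n m nm]; [exact: heart_ob|exact/SK/Shom].
- move=> x eps eps0.
  have eps20 : (0 < eps / 2)%R by rewrite divr_gt0.
  have [y [f [Fy mu_f]]] := D1 x _ eps20.
  have [n yn] := objs_onto y Fy; subst y.
  have [m [_ [v Sv]]] := servedP (inl n) 0.
  exists m, (v ∘ f); rewrite [eps]splitr.
  by apply: mu_comp_heartl => //; exact: SK.
move=> eps n y f eps0 Kf.
(* The estimate of the bonding arrow below costs six tolerances. *)
have [k] : exists k, (tol k < eps / 6)%R.
  have /ltr_add_invr[k] : (0 < eps / 6)%R by rewrite divr_gt0.
  by rewrite add0r; exists k.
move: (tol0 k); set d := tol k => d0 d_eps.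
pose L := A (u n) k (Su.1 n).
have Ki := SK _ _ _ (anchor_sub_in L); have Kj := SK _ _ _ (anchor_sub_out L).
have := anchor_lt L.
move: Ki Kj; set i := anchor_in L; set j := anchor_out L; set h := anchor_hom L.
move=> Ki Kj ji.
(* Amalgamating f with the entry i of the anchor of u_n gives an arrow g' ∘ j
   that starts at an object of F, so that domination applies to it. *)
have [w [f' [g' [Kf' Kg' fi]]]] := amalgK _ _ _ _ _ _ Kf Ki d0.
have [b [q [r [Fr mu_q qr]]]] := D2 _ _ _ _ d0 (anchor_sub_ob L) (sub_comp Kg' Kj).
have [l rl] := (arrP _ (anchor_sub_ob L)).2 b r Fr.
have [m [nm /(_ (Su.1 n))]] := servedP (inr (k, l)) n.
rewrite /link rl /= -/d -/L -/h => -[v Sv vrh].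
exists m, nm, (v ∘ (q ∘ f')); split.
  have : (mu (v ∘ (q ∘ f')) < (d + d)%:E)%E.
    by apply: mu_comp_heartl => //; [exact: SK|exact: mu_comp_heartr].
  by move/lt_trans; apply; rewrite lte_fin; lra.
rewrite rhoC.
have chain : (rho (v ∘ (q ∘ f') ∘ f) (sq_hom u (ltnW nm)) <
    (d + (d + (d + (d + d + d))))%:E)%E.
  apply: (@rho_lt_trans _ _ _ _ (v ∘ (q ∘ (g' ∘ i)))).
    by rewrite -!compA; do 2!apply: rho_lt_compl.
  apply: (@rho_lt_trans _ _ _ _ (v ∘ (q ∘ (g' ∘ (j ∘ h))))).
    by rewrite rhoC; do 3!apply: rho_lt_compl.
  apply: rho_lt_trans vrh; apply: rho_lt_compl.
  by rewrite [g' ∘ _]compA [q ∘ _]compA; apply: rho_lt_compr.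
by apply: lt_trans chain _; rewrite lte_fin; lra.
Qed.

(** * The subcategory generated by a sequence *)

(** The bonding arrows alone need not be closed under composition, as an object
may occur several times in the sequence. *)
Inductive generated (C : category) (u : omega_sequence C) :
    forall a b : C, hom a b -> Prop :=
| generated_idn n : generated u (idn (u n))
| generated_comp n m (nm : (n <= m)%N) b (g : hom (u m) b) :
    generated u g -> generated u (g ∘ sq_hom u nm).

Lemma generated_dom (C : category) (u : omega_sequence C) (a b : C)
    (f : hom a b) : generated u f -> range u a.
Proof. by case=> [n|n m nm b' g _]; exists n. Qed.

Lemma generated_cod (C : category) (u : omega_sequence C) (a b : C)
    (f : hom a b) : generated u f -> range u b.
Proof. by elim=> [n|//]; exists n. Qed.

Lemma generated_idn_range (C : category) (u : omega_sequence C) (a : C) :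
  range u a -> generated u (idn a).
Proof. by case=> n _ <-; exact: generated_idn. Qed.

Lemma generated_closed (C : category) (u : omega_sequence C) (a b c : C)
    (g : hom b c) (f : hom a b) :
  generated u g -> generated u f -> generated u (g ∘ f).
Proof.
move=> gen_g gen_f; elim: gen_f c g gen_g => {a b f} [n|n m nm b f _ IHf] c g gen_g.
  by rewrite comp_idr.
by rewrite compA; apply/generated_comp/IHf.
Qed.

Definition generated_subcategory (C : category) (u : omega_sequence C) :
    subcategory C :=
  Subcategory (@generated_dom C u) (@generated_cod C u)
    (@generated_idn_range C u) (@generated_closed C u).

Lemma generated_hom (C : category) (u : omega_sequence C) (n m : nat)
    (nm : (n <= m)%N) : generated u (sq_hom u nm).
Proof.
by rewrite -[sq_hom u nm]comp_idl; apply/generated_comp/generated_idn.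
Qed.

(** Composition totalized on pairs of arrows that do not match, so that finite
words of bonding arrows can be evaluated. *)
Definition precompose (C : category) (a b : C) (f : hom a b)
    (p : {x : C & {y : C & hom x y}}) : {x : C & {y : C & hom x y}} :=
  let: existT x (existT y g) := p in
  if pselect (b = x) is left e
  then existT _ a (existT (fun y => hom a y) y (g ∘ ecast z (hom a z) e f))
  else p.

Lemma precomposeE (C : category) (a b c : C) (g : hom b c) (f : hom a b) :
  precompose f (existT _ b (existT _ c g)) = existT _ a (existT _ c (g ∘ f)).
Proof.
rewrite /precompose; case: pselect => // e.
by rewrite (Prop_irrelevance e erefl).
Qed.

Lemma generated_countable (C : category) (u : omega_sequence C) :
  countable_subcategory (generated_subcategory u).
Proof.
pose word_arrow (w : nat * seq (nat * nat)) : {x : C & {y : C & hom x y}} :=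
  foldr (fun p => precompose (sq_hom u (leq_addr p.2 p.1)))
    (existT _ (u w.1) (existT (fun y => hom _ y) _ (idn (u w.1)))) w.2.
apply: (@sub_countable _ _ _ (range word_arrow)); last first.
  exact: sub_countable (card_image_le _ _) (countableP _).
apply: subset_card_le => -[a [b f]] /= gen_f.
elim: gen_f => {a b f} [n|n m nm b g _ [[k w] _ kw]]; first by exists (n, [::]).
have [d m_def] : exists d, m = (n + d)%N by exists (m - n)%N; rewrite subnKC.
subst m; exists (k, (n, d) :: w) => //=.
change (precompose (sq_hom u (leq_addr d n)) (word_arrow (k, w)) =
  existT _ (u n) (existT _ b (g ∘ sq_hom u nm))).
rewrite kw precomposeE.
by rewrite (bool_irrelevance (leq_addr d n) nm).
Qed.

(** Conditions (U) and (A) are (D1) and (D2) with the bonding arrows as the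
F-arrows. *)
Lemma generated_dominating (R : realType) (K : normed_category R)
    (u : omega_sequence K) :
  fraisse u -> dominating (generated_subcategory u).
Proof.
move=> [[_ Ku] U A]; split.
- split=> [a _|a b f gen_f]; first exact: heart_ob.
  elim: gen_f => {a b f} [n|n m nm b g _ Kg].
    exact/sub_idn/heart_ob.
  by apply: sub_comp.
- move=> x eps eps0; have [n [f mu_f]] := U x eps eps0.
  by exists (u n), f; split=> //; exists n.
move=> eps a y f eps0 [n _ un]; subst a => Kf.
have [m [nm [g [mu_g ug]]]] := A eps n y f eps0 Kf.
exists (u m), g, (sq_hom u (ltnW nm)); split=> //; first exact: generated_hom.
by rewrite rhoC.
Qed.

(** * Existence of anchors, and the equivalence *)

Lemma is_subcategory_of_refl (C : category) (F : subcategory C) :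
  is_subcategory_of F F.
Proof. by split=> [a|a b f]. Qed.

Lemma anchor_in_domain (R : realType) (K : metric_category R)
    (F : subcategory K) (a : K) (d : R) :
  sub_ob F a -> (0 < d)%R -> inhabited (anchor F F a d).
Proof.
move=> Fa d0; exists.
apply: (@Anchor _ _ _ _ _ _ a (idn a) a (idn a) (idn a)) => //;
  try exact: sub_idn.
by rewrite comp_idl (rho_eq0 _ _).2// lte_fin.
Qed.

Lemma anchor_in_heart (R : realType) (K : normed_category R)
    (F : subcategory K) (a : K) (d : R) :
  dominating F -> (0 < d)%R -> inhabited (anchor F (heart K) a d).
Proof.
move=> [_ D1 _] d0.
have [y [f [Fy /mu_ltP[c [j [i [Kj Ki ji]]]]]]] := D1 a d d0.
by exists; exact: Anchor ji.
Qed.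

Theorem theorem3p3 (R : realType) (K : normed_category R)
    (K_nonempty : inhabited K)
    (K_directed : directed (heart K))
    (K_amalgamation : almost_amalgamation (heart K)) :
  (separable K <-> exists u : omega_sequence K, fraisse u) /\
  (forall F : subcategory K,
     countable_subcategory F -> directed F -> dominating F ->
     almost_amalgamation F ->
     exists u : omega_sequence K, sequence_in F u /\ fraisse u).
Proof.
split; last first.
  move=> F countF dirF domF amalgF.
  apply: (fraisse_sequence_in K_nonempty K_amalgamation countF domF) => //.
  - exact: is_subcategory_of_refl.
  - by have [] := domF.
  - by move=> a d; exact: anchor_in_domain.
split=> [[F [countF domF]]|[u fraisse_u]]; last first.
  exists (generated_subcategory u); split; first exact: generated_countable.
  exact: generated_dominating.
have [FK _ _] := domF.
have [] := @fraisse_sequence_in _ _ _ (heart K) K_nonempty K_amalgamation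
  countF domF => //.
- exact: is_subcategory_of_refl.
- by move=> a d _; exact: anchor_in_heart.
by move=> u [_ fraisse_u]; exists u.
Qed.
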